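(* Let $(x_1,y_1),\dots,(x_N,y_N)\in\mathbb{R}^2$ be given data points, with associated vectors $P_i\in\mathbb{R}^8$ and matrix $P=(p_{jk})\in\mathbb{R}^{8\times 8}$ (see context). Put $$P_0=\begin{pmatrix} p_{11} & p_{12} \\ p_{21} & p_{22} \end{pmatrix},\quad P_1^0=\begin{pmatrix} p_{13} & p_{16} \\ p_{23} & p_{26} \end{pmatrix},\quad P_c^0=\begin{pmatrix} p_{33} & p_{36} \\ p_{63} & p_{66} \end{pmatrix},\quad B_c^0=\begin{pmatrix} 0 & -1 \\ -1 & 0 \end{pmatrix},$$ and assume $P_0$ is invertible. Consider the optimisation problem of minimising $$Q^0\mapsto\sum_{i=1}^N(P_i\cdot Q^0)^2$$ over all vectors of the form $Q^0=\begin{pmatrix}\bar v^\times&\bar v^-&\bar v^+&0&0&v^+&0&0\end{pmatrix}^T\in\mathbb{R}^8$ subject to the constraint $(Q^0)^2:=Q^0\cdot Q^0=1$. Then the solution is given by $Q^0=\begin{pmatrix}w^T&\bar v^+&0&0&v^+&0&0\end{pmatrix}^T$, where $v^0=\begin{pmatrix}\bar v^+&v^+\end{pmatrix}^T\in\mathbb{R}^2$ is an eigenvector, normalised by $(v^0)^TB_c^0v^0=1$, corresponding to the minimal non-negative eigenvalue of $$P_{con}^0=B_c^0\left(P_c^0-(P_1^0)^TP_0^{-1}P_1^0\right),$$ and $w=\begin{pmatrix}\bar v^\times&\bar v^-\end{pmatrix}^T\in\mathbb{R}^2$ is the vector $w=-P_0^{-1}P_1^0v^0$.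
   Context: On $\mathbb{R}^8$ (the vector space $\mathbb{R}^{5,3}$ underlying Geometric Algebra for Conics, with coordinates ordered as $\bar n_\times,\bar n_-,\bar n_+,e_1,e_2,n_+,n_-,n_\times$) the inner product is $X\cdot Y=X^TBY$, where $B$ is the symmetric $8\times 8$ matrix with $B_{44}=B_{55}=1$, $B_{j,9-j}=-1$ for $j\in\{1,2,3,6,7,8\}$, and all other entries zero. A point $(x_i,y_i)$ is represented by $$P_i=\begin{pmatrix}0&0&1&x_i&y_i&\tfrac12(x_i^2+y_i^2)&\tfrac12(x_i^2-y_i^2)&x_iy_i\end{pmatrix}^T,$$ and $P=\sum_{i=1}^N BP_iP_i^TB$, a symmetric $8\times 8$ matrix, so that $\sum_i(P_i\cdot Q)^2=Q^TPQ$. ''Solution'' of the optimisation problem means a (global) minimiser of the objective function on the set of admissible vectors satisfying the constraint.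
   Formalization: If the minimal non-negative eigenvalue is 0, it may have no eigenvector with (v^0)^T B_c^0 v^0 = 1 (e.g. points (0,1),(2,3),(2,-3)); the solution formula is then not claimed. It is proved whenever such an eigenvector exists, in particular for any non-zero minimal eigenvalue. *)

(* Defs.v *)
From mathcomp Require Import all_boot all_order all_algebra.
From mathcomp Require Import reals.

Set Implicit Arguments.
Unset Strict Implicit.
Unset Printing Implicit Defensive.

Import Order.TTheory GRing.Theory Num.Theory.
Local Open Scope ring_scope.

(* The [j]-th coordinate index, [j] counted from 1 to 8. *)
Definition gac_coord (j : nat) : 'I_8 := inord j.-1.

Definition vec8 (R : realType) (s : seq R) : 'cV[R]_8 := \col_(i < 8) s`_i.

(* Indices count from 0 here, so that B_44 = B_55 = 1 sits at positions 3 and 4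
   and the entries (j, 9 - j) are those with [j + k = 7]. *)
Definition Bmx (R : realType) : 'M[R]_8 :=
  \matrix_(j < 8, k < 8)
    if (j == 3 :> nat) || (j == 4 :> nat) then (j == k)%:R
    else - (j + k == 7)%N%:R.

Definition gac_dot (R : realType) (X Y : 'cV[R]_8) : R :=
  (X^T *m Bmx R *m Y) 0 0.

Definition gac_point (R : realType) (x y : R) : 'cV[R]_8 :=
  vec8 [:: 0; 0; 1; x; y; (x ^+ 2 + y ^+ 2) / 2; (x ^+ 2 - y ^+ 2) / 2; x * y].

Definition Pmx (R : realType) (N : nat) (x y : 'I_N -> R) : 'M[R]_8 :=
  \sum_(i < N)
    Bmx R *m gac_point (x i) (y i) *m (gac_point (x i) (y i))^T *m Bmx R.

(* Rows [j1, j2] and columns [k1, k2] of [A], counted from 1. *)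
Definition sub22 (R : realType) (A : 'M[R]_8) (j1 j2 k1 k2 : nat) : 'M[R]_2 :=
  \matrix_(a < 2, b < 2)
    A (gac_coord (if a == 0 then j1 else j2)) (gac_coord (if b == 0 then k1 else k2)).

Definition P0mx (R : realType) (N : nat) (x y : 'I_N -> R) : 'M[R]_2 :=
  sub22 (Pmx x y) 1 2 1 2.

Definition P10mx (R : realType) (N : nat) (x y : 'I_N -> R) : 'M[R]_2 :=
  sub22 (Pmx x y) 1 2 3 6.

Definition Pc0mx (R : realType) (N : nat) (x y : 'I_N -> R) : 'M[R]_2 :=
  sub22 (Pmx x y) 3 6 3 6.

Definition Bc0mx (R : realType) : 'M[R]_2 :=
  \matrix_(a < 2, b < 2) - (a != b)%:R.

Definition Pcon0mx (R : realType) (N : nat) (x y : 'I_N -> R) : 'M[R]_2 :=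
  Bc0mx R *m
    (Pc0mx x y - (P10mx x y)^T *m invmx (P0mx x y) *m P10mx x y).

Definition objective (R : realType) (N : nat) (x y : 'I_N -> R)
    (Q : 'cV[R]_8) : R :=
  \sum_(i < N) gac_dot (gac_point (x i) (y i)) Q ^+ 2.

Definition feasible (R : realType) (Q : 'cV[R]_8) : Prop :=
  (exists a b c d : R, Q = vec8 [:: a; b; c; 0; 0; d; 0; 0])
  /\ gac_dot Q Q = 1.

Definition is_solution (R : realType) (N : nat) (x y : 'I_N -> R)
    (Q : 'cV[R]_8) : Prop :=
  feasible Q /\
  forall Q' : 'cV[R]_8, feasible Q' -> objective x y Q <= objective x y Q'.

(* [eigenvalue] is defined with row eigenvectors; a square matrix over a field
   has the same eigenvalues for row and for column eigenvectors. *)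
Definition min_nonneg_eigenvalue (R : realType) (n : nat) (A : 'M[R]_n)
    (lam : R) : Prop :=
  [/\ eigenvalue A lam, 0 <= lam &
      forall mu : R, eigenvalue A mu -> 0 <= mu -> lam <= mu].

Definition eigenvector (R : realType) (n : nat) (A : 'M[R]_n) (lam : R)
    (v : 'cV[R]_n) : Prop :=
  v != 0 /\ A *m v = lam *: v.

Definition normalised_eigenvector (R : realType) (N : nat) (x y : 'I_N -> R)
    (lam : R) (v : 'cV[R]_2) : Prop :=
  eigenvector (Pcon0mx x y) lam v /\ (v^T *m Bc0mx R *m v) 0 0 = 1.

Definition Q_of (R : realType) (N : nat) (x y : 'I_N -> R) (v : 'cV[R]_2) :
    'cV[R]_8 :=
  let w : 'cV[R]_2 := - (invmx (P0mx x y) *m P10mx x y *m v) in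
  vec8 [:: w 0 0; w 1 0; v 0 0; 0; 0; v 1 0; 0; 0].

(* Main.v *)
Require Import Defs.
From mathcomp Require Import all_boot all_order all_algebra.
From mathcomp Require Import reals ring lra.

Set Implicit Arguments.
Unset Strict Implicit.
Unset Printing Implicit Defensive.

Import Order.TTheory GRing.Theory Num.Theory.
Local Open Scope ring_scope.

(** Write an admissible vector as a pair [u = (v̄^×, v̄^-)], [v = (v̄^+, v^+)].
    The objective is the quadratic form of [P], and completing the square in [u]
    turns it into [(u + P0^-1 P1 v)^T P0 (u + P0^-1 P1 v) + v^T S v], where
    [S = Pc - P1^T P0^-1 P1] is the Schur complement, while the constraint reads
    [v^T B v = 1] and involves [v] only ([schur_square], [objective_schur],
    [feasibleP]).  As a sum of squares the objective is nonnegative, so [P0] and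
    [S] are positive semidefinite, and [P0], being invertible, is definite.

    Since [B] is an involution, [lam] is an eigenvalue of [B S] exactly when the
    pencil [S - lam B] is singular.  The diagonal of [B] vanishes, so [S - lam B]
    keeps the nonnegative diagonal of [S]; a singular symmetric 2x2 matrix with
    nonnegative diagonal is positive semidefinite ([pencil_psd]).  Hence
    [v^T S v >= lam] on the constraint, with equality exactly on the kernel of
    [S - lam B], that is, on the normalised eigenvectors ([psd_ker], [pencilP]).
    As soon as one of them exists, the minimum is thus [lam], and it is reached
    exactly when [u = - P0^-1 P1 v] and [v] is a normalised eigenvector
    ([solution_char]).

    With [S = [s t; t r]] the eigenvalues of [B S] are [- t ± sqrt (s r)], and
    [t ^ 2 <= s r] puts them on either side of [0]; so a least nonnegative one
    exists ([min_nonneg_eigenvalue_exists]).  If it is positive, an eigenvector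
    has [lam v^T B v = v^T S v >= 0], and this cannot vanish because [S v = 0]
    would give [v = 0]: it can be normalised ([normalised_exists]). *)

(** * Quadratic forms *)

Definition qform {R : realType} {n : nat} (A : 'M[R]_n) (v : 'cV[R]_n) : R :=
  (v^T *m A *m v) 0 0.

Definition psd {R : realType} {n : nat} (A : 'M[R]_n) : Prop :=
  A^T = A /\ forall v, 0 <= qform A v.

Lemma bilin_sym {R : realType} {m n : nat} (A : 'M[R]_(m, n))
    (u : 'cV_m) (v : 'cV_n) :
  (u^T *m A *m v) 0 0 = (v^T *m A^T *m u) 0 0.
Proof.
have -> : v^T *m A^T *m u = (u^T *m A *m v)^T by rewrite !trmx_mul trmxK mulmxA.
by rewrite [RHS]mxE.
Qed.

Lemma qformD {R : realType} {n : nat} (A : 'M[R]_n) u v : A^T = A ->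
  qform A (u + v) = qform A u + 2 * (u^T *m A *m v) 0 0 + qform A v.
Proof.
move=> symA; rewrite /qform [(u + v)^T]raddfD /= !mulmxDl !mulmxDr.
rewrite ![fun_of_matrix (_ + _) 0 0]mxE.
by rewrite [(v^T *m A *m u) 0 0]bilin_sym symA; ring.
Qed.

Lemma qformZ {R : realType} {n : nat} (A : 'M[R]_n) a v :
  qform A (a *: v) = a ^+ 2 * qform A v.
Proof.
rewrite /qform [(a *: v)^T]linearZ /= -!scalemxAl -scalemxAr.
by rewrite ![fun_of_matrix (_ *: _) 0 0]mxE; ring.
Qed.

Lemma qformB {R : realType} {n : nat} (A B : 'M[R]_n) a v :
  qform (A - a *: B) v = qform A v - a * qform B v.
Proof.
rewrite /qform mulmxBr mulmxBl -scalemxAr -scalemxAl.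
by rewrite [LHS]mxE [fun_of_matrix (- _) 0 0]mxE [fun_of_matrix (_ *: _) 0 0]mxE.
Qed.

Lemma dot_eq0 {R : realType} {n : nat} (v : 'cV[R]_n) :
  (v^T *m v) 0 0 = 0 -> v = 0.
Proof.
rewrite mxE => /eqP; rewrite psumr_eq0 => [/allP v0|i _]; last first.
  by rewrite mxE -expr2 sqr_ge0.
apply/matrixP=> i j; rewrite ord1 [RHS]mxE.
by have := v0 i (mem_index_enum _); rewrite mxE mulf_eq0 orbb => /eqP.
Qed.

(** With [w = A v] and [q] the value of the form at [w], its value at [v - e w] is
    [- 2 e |w|^2 + e^2 q]; a small positive [e] makes it negative unless [w = 0].
    The choice [e = |w|^2 / (q + 1)] is small enough. *)
Lemma psd_ker {R : realType} {n : nat} (A : 'M[R]_n) v :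
  psd A -> qform A v = 0 -> A *m v = 0.
Proof.
move=> [symA A0] v0; apply: dot_eq0; set w := A *m v.
set q := qform A w; have q0 : 0 <= q by exact: A0.
set p := (_ : 'M_1) 0 0; have p0 : 0 <= p.
  by rewrite /p mxE sumr_ge0 // => i _; rewrite mxE -expr2 sqr_ge0.
have pE : (v^T *m A *m w) 0 0 = p by rewrite /p {2}/w trmx_mul symA.
have q1 : 0 < q + 1 by lra.
have := A0 (v + (- (p / (q + 1))) *: w).
rewrite qformD // qformZ -scalemxAr v0 [fun_of_matrix (_ *: _) 0 0]mxE pE -/q.
set e := p / (q + 1).
have ep : p = e * (q + 1) by rewrite /e; field; rewrite gt_eqF.
rewrite ep => h.
have e0 : e ^+ 2 = 0 by have := sqr_ge0 e; nra.
by move/eqP: e0; rewrite sqrf_eq0 => /eqP ->; rewrite mul0r.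
Qed.

(** Completing the square in [u]: the Schur complement is the form in [v] that
    remains once [u] is chosen as [- A^-1 C v]. *)
Lemma schur_square {R : realType} {m n : nat} (A : 'M[R]_m) (C : 'M[R]_(m, n))
    (D : 'M[R]_n) (u : 'cV_m) (v : 'cV_n) : A^T = A -> A \in unitmx ->
  qform A u + 2 * (u^T *m C *m v) 0 0 + qform D v =
  qform A (u + invmx A *m C *m v) + qform (D - C^T *m invmx A *m C) v.
Proof.
move=> symA unitA; rewrite qformD // -[X in _ - X]scale1r qformB mul1r.
have -> : u^T *m A *m (invmx A *m C *m v) = u^T *m C *m v.
  by rewrite !mulmxA mulmxK.
suff -> : qform A (invmx A *m C *m v) = qform (C^T *m invmx A *m C) v by ring.
by rewrite /qform !trmx_mul trmx_inv symA !mulmxA mulmxKV.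
Qed.

(** * Eigenvalues and 2x2 pencils *)

Lemma eigenvalue_det {R : realType} {n : nat} (A : 'M[R]_n) a :
  eigenvalue A a = (\det (A - a%:M) == 0).
Proof.
by rewrite /eigenvalue /eigenspace kermx_eq0 row_free_unit unitmxE unitfE negbK.
Qed.

Lemma eigenvector_exists {R : realType} {n : nat} (A : 'M[R]_n) a :
  eigenvalue A a -> exists v, eigenvector A a v.
Proof.
rewrite eigenvalue_det -det_tr => /det0P[v v0 vA]; exists v^T; split.
  by apply: contra_neq v0 => /(congr1 trmx); rewrite trmxK trmx0.
have := congr1 trmx vA; rewrite trmx_mul trmxK trmx0 mulmxBl mul_scalar_mx.
by move/eqP; rewrite subr_eq0 => /eqP.
Qed.

Lemma sum2 {R : realType} (F : 'I_2 -> R) : \sum_i F i = F 0 + F 1.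
Proof. by rewrite big_ord_recl big_ord1; congr (_ + F _); apply/val_inj. Qed.

Lemma ord2_cases (P : 'I_2 -> Prop) : P 0 -> P 1 -> forall i, P i.
Proof.
move=> P0 P1 [[|[|//]] lti]; first by rewrite (_ : Ordinal lti = 0) //; apply/val_inj.
by rewrite (_ : Ordinal lti = 1) //; apply/val_inj.
Qed.

Lemma det2 {R : realType} (A : 'M[R]_2) :
  \det A = A 0 0 * A 1 1 - A 0 1 * A 1 0.
Proof.
have l0 : lift (0 : 'I_2) 0 = 1 by apply/val_inj.
have l1 : lift (1 : 'I_2) 0 = 0 by apply/val_inj.
rewrite (expand_det_row A 0) sum2 /cofactor !det_mx11 !mxE l0 l1 /=.
by rewrite expr0 mul1r expr1 mulN1r mulrN.
Qed.

Lemma qform2 {R : realType} (A : 'M[R]_2) v : A^T = A ->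
  qform A v = A 0 0 * v 0 0 ^+ 2 + 2 * A 0 1 * v 0 0 * v 1 0 + A 1 1 * v 1 0 ^+ 2.
Proof.
move=> symA; have A10 : A 1 0 = A 0 1 by rewrite -{1}symA mxE.
by rewrite /qform mxE !sum2 !mxE !sum2 !mxE A10; ring.
Qed.

Lemma psd2 {R : realType} (A : 'M[R]_2) : A^T = A ->
  0 <= A 0 0 -> 0 <= A 1 1 -> A 0 1 ^+ 2 <= A 0 0 * A 1 1 -> psd A.
Proof.
move=> symA s0 r0 tsr; split=> // v; rewrite qform2 //.
move: (A 0 0) (A 0 1) (A 1 1) (v 0 0) (v 1 0) s0 r0 tsr => s t r c d s0 r0 tsr.
have [s1|s1] := ltrP 0 s.
  have -> : s * c ^+ 2 + 2 * t * c * d + r * d ^+ 2 =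
      ((s * c + t * d) ^+ 2 + (s * r - t ^+ 2) * d ^+ 2) / s.
    by field; rewrite gt_eqF.
  by rewrite divr_ge0 // addr_ge0 ?sqr_ge0 // mulr_ge0 ?sqr_ge0 ?subr_ge0.
have s2 : s = 0 by lra.
have t0 : t = 0.
  by apply/eqP; rewrite -sqrf_eq0 eq_le sqr_ge0 andbT; move: tsr; rewrite s2 mul0r.
by rewrite s2 t0 !(mulr0, mul0r, add0r) mulr_ge0 ?sqr_ge0.
Qed.

Lemma psd2_inv {R : realType} (A : 'M[R]_2) : psd A ->
  [/\ 0 <= A 0 0, 0 <= A 1 1 & A 0 1 ^+ 2 <= A 0 0 * A 1 1].
Proof.
move=> psdA; have [symA A0] := psdA.
pose v c d : 'cV[R]_2 := \col_i (if i == 0 then c else d).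
have qv c d : qform A (v c d) =
    A 0 0 * c ^+ 2 + 2 * A 0 1 * c * d + A 1 1 * d ^+ 2.
  by rewrite qform2 // !mxE.
have s0 : 0 <= A 0 0 by have := A0 (v 1 0); rewrite qv; lra.
split=> //; first by have := A0 (v 0 1); rewrite qv; lra.
have [sp|sn] := ltrP 0 (A 0 0).
  (* at this vector the form is [A 0 0] times the determinant *)
  by have := A0 (v (- A 0 1) (A 0 0)); rewrite qv; nra.
have sE : A 0 0 = 0 by lra.
(* a zero diagonal entry makes the first basis vector isotropic *)
have /matrixP/(_ 1 0) : A *m v 1 0 = 0.
  by apply: psd_ker => //; rewrite qv sE; ring.
rewrite !mxE sum2 !mxE /=.
rewrite -{1}symA mxE mulr1 mulr0 addr0 sE => ->.
by rewrite expr0n mul0r.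
Qed.

Lemma Bc0_sym {R : realType} : (Bc0mx R)^T = Bc0mx R.
Proof. by apply/matrixP=> i j; rewrite !mxE eq_sym. Qed.

Lemma Bc0_invol {R : realType} : Bc0mx R *m Bc0mx R = 1%:M.
Proof.
apply/matrixP; elim/ord2_cases; elim/ord2_cases;
  rewrite !mxE sum2 !mxE /=; ring.
Qed.

(** Trading the non-symmetric [B S - lam] for the symmetric [S - lam B] opens the
    eigenvector equation to the theory of quadratic forms; multiplication by the
    involution [B] goes either way. *)
Lemma pencilP {R : realType} (S : 'M[R]_2) lam (v : 'cV_2) :
  Bc0mx R *m S *m v = lam *: v <-> (S - lam *: Bc0mx R) *m v = 0.
Proof.
rewrite mulmxBl -scalemxAl; split=> [h|/eqP].
  by rewrite -(mul1mx (S *m v)) -Bc0_invol -mulmxA (mulmxA _ S) h -scalemxAr subrr.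
rewrite subr_eq0 => /eqP h.
by rewrite -mulmxA h -scalemxAr mulmxA Bc0_invol mul1mx.
Qed.

Lemma eigenvalue_pencil {R : realType} (S : 'M[R]_2) lam : S^T = S ->
  eigenvalue (Bc0mx R *m S) lam = ((S 0 1 + lam) ^+ 2 == S 0 0 * S 1 1).
Proof.
move=> symS; have S10 : S 1 0 = S 0 1 by rewrite -{1}symS mxE.
rewrite eigenvalue_det det2 !mxE !sum2 !mxE /= S10.
by rewrite -[RHS]subr_eq0; congr (_ == 0); ring.
Qed.

(** The diagonal of [B] vanishes, so [S - lam B] inherits the diagonal of [S];
    its determinant is zero because [lam] is an eigenvalue of [B S]. *)
Lemma pencil_psd {R : realType} (S : 'M[R]_2) lam : psd S ->
  eigenvalue (Bc0mx R *m S) lam -> psd (S - lam *: Bc0mx R).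
Proof.
move=> psdS; have [symS _] := psdS; have [s0 r0 _] := psd2_inv psdS.
rewrite eigenvalue_pencil // => /eqP det0.
apply: psd2; rewrite ?mxE /= ?oppr0 ?mulr0 ?subr0 //.
- by rewrite linearB linearZ /= symS Bc0_sym.
- by rewrite mulrN1 opprK det0.
Qed.

(** On an eigenvector [lam v^T B v = v^T S v >= 0].  Were it zero, semidefiniteness
    would give [S v = 0], hence [lam v = B S v = 0].  For [lam = 0] this breaks
    down: the kernel of [S] may consist of vectors with [v^T B v <= 0]. *)
Lemma normalised_exists {R : realType} (S : 'M[R]_2) lam : psd S ->
  eigenvalue (Bc0mx R *m S) lam -> 0 < lam ->
  exists v, eigenvector (Bc0mx R *m S) lam v /\ qform (Bc0mx R) v = 1.
Proof.
move=> psdS /eigenvector_exists[v [v0 vE]] lam0.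
have qE : qform S v = lam * qform (Bc0mx R) v.
  move/pencilP: vE => h; apply/eqP; rewrite -subr_eq0 -qformB.
  by rewrite /qform -mulmxA h mulmx0 mxE.
have q0 : 0 <= qform (Bc0mx R) v by rewrite -(pmulr_rge0 _ lam0) -qE psdS.2.
have qp : 0 < qform (Bc0mx R) v.
  rewrite lt_def q0 andbT; apply: contra_neq v0 => qB0.
  have Sv0 : S *m v = 0 by apply: psd_ker => //; rewrite qE qB0 mulr0.
  move/eqP: vE; rewrite -mulmxA Sv0 mulmx0 eq_sym scaler_eq0 gt_eqF //=.
  by move/eqP.
exists ((Num.sqrt (qform (Bc0mx R) v))^-1 *: v); split; last first.
  by rewrite qformZ exprVn sqr_sqrtr // mulVf ?gt_eqF.
split; last by rewrite -scalemxAr vE scalerA mulrC -scalerA.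
by rewrite scaler_eq0 invr_eq0 sqrtr_eq0 leNgt qp.
Qed.

(** The eigenvalues are [- t ± sqrt (s r)], where [s, r] is the diagonal of [S] and
    [t] its other entry, and semidefiniteness gives [|t| <= sqrt (s r)]. *)
Lemma min_nonneg_eigenvalue_exists {R : realType} (S : 'M[R]_2) : psd S ->
  exists lam, min_nonneg_eigenvalue (Bc0mx R *m S) lam.
Proof.
move=> psdS; have [symS _] := psdS; have [s0 r0 tsr] := psd2_inv psdS.
set m := Num.sqrt (S 0 0 * S 1 1); have m0 : 0 <= m by exact: sqrtr_ge0.
have mE : m ^+ 2 = S 0 0 * S 1 1 by rewrite sqr_sqrtr // mulr_ge0.
have eigE mu : eigenvalue (Bc0mx R *m S) mu =
    (mu == - S 0 1 + m) || (mu == - S 0 1 - m).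
  rewrite eigenvalue_pencil // -mE eqf_sqr.
  by congr (_ || _); rewrite -subr_eq0 -[RHS]subr_eq0; congr (_ == 0); ring.
have tm : `|S 0 1| <= m by rewrite -sqrtr_sqr ler_wsqrtr.
move: tm; rewrite ler_norml => /andP[tm1 tm2].
(* the smaller root is nonpositive, hence relevant only when it vanishes *)
have [z|nz] := eqVneq (- S 0 1 - m) 0.
  by exists 0; split=> //; rewrite eigE -z eqxx orbT.
exists (- S 0 1 + m); split; first by rewrite eigE eqxx.
  lra.
move=> mu; rewrite eigE => /orP[/eqP -> //|/eqP -> mu0].
by case/negP: nz; rewrite eq_le mu0 andbT; lra.
Qed.

(** * The conic fitting problem *)

Definition admissible {R : realType} (u v : 'cV[R]_2) : 'cV[R]_8 :=
  vec8 [:: u 0 0; u 1 0; v 0 0; 0; 0; v 1 0; 0; 0].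

Lemma sum8 {R : realType} (F : 'I_8 -> R) :
  \sum_i F i = F (gac_coord 1) + F (gac_coord 2) + F (gac_coord 3)
    + F (gac_coord 4) + F (gac_coord 5) + F (gac_coord 6) + F (gac_coord 7)
    + F (gac_coord 8).
Proof.
rewrite !big_ord_recl big_ord0 addr0 !addrA.
by do 8?[congr (_ + _)]; congr F; apply/val_inj; rewrite /= inordK.
Qed.

Lemma Bmx_sym {R : realType} : (Bmx R)^T = Bmx R.
Proof.
apply/matrixP=> i j; rewrite !mxE.
by case: i j => [[|[|[|[|[|[|[|[|//]]]]]]]] ?] [[|[|[|[|[|[|[|[|//]]]]]]]] ?];
  rewrite //= oppr0.
Qed.

Lemma Pmx_sym {R : realType} {N} (x y : 'I_N -> R) : (Pmx x y)^T = Pmx x y.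
Proof.
rewrite /Pmx linear_sum; apply: eq_bigr => i _ /=.
by rewrite !trmx_mul trmxK Bmx_sym !mulmxA.
Qed.

Lemma objective_qform {R : realType} {N} (x y : 'I_N -> R) Q :
  objective x y Q = qform (Pmx x y) Q.
Proof.
rewrite /objective /qform /Pmx mulmx_sumr mulmx_suml summxE.
apply: eq_bigr => i _; rewrite /gac_dot; set p := gac_point _ _.
have -> : Q^T *m (Bmx R *m p *m p^T *m Bmx R) *m Q =
    (p^T *m Bmx R *m Q)^T *m (p^T *m Bmx R *m Q).
  by rewrite !trmx_mul trmxK Bmx_sym !mulmxA.
by rewrite [RHS]mxE big_ord1 [_^T _ _]mxE.
Qed.

(** The coordinates of an admissible vector live at positions 1, 2 (for [u]) and
    3, 6 (for [v]), which is why only these blocks of [P] matter. *)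
Lemma objective_blocks {R : realType} {N} (x y : 'I_N -> R) u v :
  objective x y (admissible u v) =
  qform (P0mx x y) u + 2 * (u^T *m P10mx x y *m v) 0 0 + qform (Pc0mx x y) v.
Proof.
rewrite objective_qform /qform; have symP := Pmx_sym x y.
set P := Pmx x y in symP *.
have sP j k : P j k = P k j by rewrite -{1}symP mxE.
rewrite mxE sum8 !mxE !sum8 !mxE !sum2 !mxE !sum2 !mxE.
rewrite !inordK //= -/P.
rewrite (sP (gac_coord 3) (gac_coord 1)) (sP (gac_coord 3) (gac_coord 2)).
rewrite (sP (gac_coord 6) (gac_coord 1)) (sP (gac_coord 6) (gac_coord 2)).
ring.
Qed.

Lemma gac_dot_admissible {R : realType} (u v : 'cV[R]_2) :
  gac_dot (admissible u v) (admissible u v) = qform (Bc0mx R) v.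
Proof.
rewrite qform2 ?Bc0_sym // /gac_dot mxE sum8 !mxE !sum8 !mxE.
by rewrite !inordK //= -!val_eqE /= !inordK //=; ring.
Qed.

Lemma feasibleP {R : realType} (Q : 'cV[R]_8) :
  feasible Q <-> exists u v, Q = admissible u v /\ qform (Bc0mx R) v = 1.
Proof.
split=> [[[a [b [c [d ->]]]]]|[u [v [-> qv]]]]; last first.
  by split; [exists (u 0 0), (u 1 0), (v 0 0), (v 1 0) | rewrite gac_dot_admissible].
pose pair c d : 'cV[R]_2 := \col_i (if i == 0 then c else d).
have -> : vec8 [:: a; b; c; 0; 0; d; 0; 0] = admissible (pair a b) (pair c d).
  by rewrite /admissible !mxE.
by rewrite gac_dot_admissible => qv; exists (pair a b), (pair c d).
Qed.

Section Fitting.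

Context {R : realType} {N : nat} (x y : 'I_N -> R).
Context (P0_inv : P0mx x y \in unitmx).

Let S := Pc0mx x y - (P10mx x y)^T *m invmx (P0mx x y) *m P10mx x y.
Let w (v : 'cV[R]_2) := - (invmx (P0mx x y) *m P10mx x y *m v).

Lemma objective_ge0 Q : 0 <= objective x y Q.
Proof. by apply: sumr_ge0 => i _; exact: sqr_ge0. Qed.

Lemma sub22_sym (A : 'M[R]_8) j k : A^T = A ->
  (sub22 A j k j k)^T = sub22 A j k j k.
Proof. by move=> symA; apply/matrixP=> a b; rewrite !mxE -{1}symA mxE. Qed.

Lemma P0_psd : psd (P0mx x y).
Proof.
split=> [|u]; first exact/sub22_sym/Pmx_sym.
have := objective_ge0 (admissible u 0); rewrite objective_blocks /qform.
by rewrite !mulmx0 [fun_of_matrix 0 0 0]mxE mulr0 !addr0.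
Qed.

(** For fixed [v] the first term is minimised, at zero, by [u = w v] alone. *)
Lemma objective_schur u v :
  objective x y (admissible u v) = qform (P0mx x y) (u - w v) + qform S v.
Proof. by rewrite objective_blocks schur_square ?P0_psd.1 // opprK. Qed.

Lemma objective_Q_of v : objective x y (Q_of x y v) = qform S v.
Proof.
by rewrite [LHS]objective_schur subrr /qform mulmx0 [fun_of_matrix 0 0 0]mxE add0r.
Qed.

(** A value of [v^T S v] is a value of the objective, which is a sum of squares. *)
Lemma schur_psd : psd S.
Proof.
split=> [|v]; last by rewrite -objective_Q_of objective_ge0.
rewrite /S [(_ - _)^T]linearB /= !trmx_mul trmxK trmx_inv P0_psd.1 mulmxA.
by rewrite /Pc0mx sub22_sym ?Pmx_sym.
Qed.

Lemma P0_definite u : qform (P0mx x y) u = 0 -> u = 0.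
Proof.
by move/(psd_ker P0_psd) => h; rewrite -(mulKmx P0_inv u) h mulmx0.
Qed.

(** On the constraint, [lam = lam v^T B v], so the objective exceeds [lam] by
    the sum of the two nonnegative forms in [objE]; a normalised eigenvector [v1]
    makes [lam] the minimum, and minimisers are the common zeros of the forms. *)
Lemma solution_char lam v1 : eigenvalue (Pcon0mx x y) lam ->
  normalised_eigenvector x y lam v1 -> forall Q,
  is_solution x y Q <->
  exists2 v0, normalised_eigenvector x y lam v0 & Q = Q_of x y v0.
Proof.
move=> eiglam.
have psdL : psd (S - lam *: Bc0mx R) by apply: pencil_psd => //; exact: schur_psd.
have objE u v : qform (Bc0mx R) v = 1 -> objective x y (admissible u v) =
    lam + qform (P0mx x y) (u - w v) + qform (S - lam *: Bc0mx R) v.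
  by move=> qv; rewrite objective_schur qformB qv; ring.
have min Q : feasible Q -> lam <= objective x y Q.
  move=> /feasibleP[u [v [-> qv]]]; rewrite objE // -addrA lerDl.
  by rewrite addr_ge0 ?P0_psd.2 ?psdL.2.
have att v : normalised_eigenvector x y lam v ->
    feasible (Q_of x y v) /\ objective x y (Q_of x y v) = lam.
  move=> [[_ /pencilP vE] qv]; split.
    by apply/feasibleP; exists (w v), v.
  rewrite [LHS]objE // subrr /qform mulmx0 -[_ *m _ *m v]mulmxA vE mulmx0.
  by rewrite ![fun_of_matrix 0 0 0]mxE !addr0.
move=> /att[feas1 obj1] Q; split=> [[feasQ minQ]|[v0 /att[feas0 obj0] ->]]; last first.
  by split=> // Q' /min; rewrite obj0.
have := minQ _ feas1; rewrite obj1.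
move/feasibleP: feasQ => [u [v [-> qv]]]; rewrite objE // => le.
have a0 : 0 <= qform (P0mx x y) (u - w v) by exact: P0_psd.2.
have b0 : 0 <= qform (S - lam *: Bc0mx R) v by exact: psdL.2.
have /P0_definite/eqP : qform (P0mx x y) (u - w v) = 0 by lra.
rewrite subr_eq0 => /eqP ->; exists v => //; split=> //; split.
  by apply: contra_eq_neq qv => ->; rewrite /qform mulmx0 mxE eq_sym oner_eq0.
by apply/pencilP/(psd_ker psdL); lra.
Qed.

End Fitting.

Theorem proposition3 (R : realType) (N : nat) (x y : 'I_N -> R)
  (P0_inv : P0mx x y \in unitmx) :
  exists lam : R,
    [/\ min_nonneg_eigenvalue (Pcon0mx x y) lam,
        lam != 0 ->
          exists v0 : 'cV[R]_2, normalised_eigenvector x y lam v0 &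
        (exists v0 : 'cV[R]_2, normalised_eigenvector x y lam v0) ->
          forall Q : 'cV[R]_8,
            is_solution x y Q <->
            exists2 v0 : 'cV[R]_2,
              normalised_eigenvector x y lam v0 & Q = Q_of x y v0].
Proof.
have psdS := schur_psd P0_inv.
have [lam minlam] := min_nonneg_eigenvalue_exists psdS.
have [eiglam lam0 _] := minlam.
exists lam; split=> [//|lamN0|[v1 nv1]].
  by apply: normalised_exists; rewrite // lt_def lamN0.
exact: solution_char nv1.
Qed.
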